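(* Let $t>2$ be an integer and let $q\in\mathbb{C}$ be a primitive $t$-th root of unity. There are no non-trivial transposed Poisson algebra structures on the $q$-quantum torus Lie algebra $L(q)$; that is, every transposed Poisson structure $\cdot$ on $L(q)$ satisfies $x\cdot y=0$ for all $x,y\in L(q)$.
   Context: Write $(t\mathbb{Z})^2=t\mathbb{Z}\times t\mathbb{Z}\subset\mathbb{Z}^2$, $\Gamma_1=(t\mathbb{Z})^2\setminus\{\mathbf 0\}$, $\Gamma_2=\mathbb{Z}^2\setminus(t\mathbb{Z})^2$, $\Gamma=\Gamma_1\cup\Gamma_2=\mathbb{Z}^2\setminus\{\mathbf 0\}$. For $\mathbf m=(m_1,m_2)$, $\mathbf n=(n_1,n_2)$ put $\lambda(\mathbf m,\mathbf n)=q^{m_2n_1}-q^{m_1n_2}$ and $\det\binom{\mathbf n}{\mathbf m}=m_2n_1-m_1n_2$. The $q$-quantum torus Lie algebra $L(q)$ is the complex Lie algebra with basis $\{x^{\mathbf m},D(\mathbf m)\mid\mathbf m\in\Gamma\}$ and anticommutative bracket given, for $\mathbf m,\mathbf n\in\Gamma$, by $[x^{\mathbf m},x^{\mathbf n}]=\lambda(\mathbf m,\mathbf n)x^{\mathbf m+\mathbf n}$, $[D(\mathbf m),x^{\mathbf n}]=h(\mathbf m,\mathbf n)x^{\mathbf m+\mathbf n}$, $[D(\mathbf m),D(\mathbf n)]=g(\mathbf m,\mathbf n)D(\mathbf m+\mathbf n)$, where $h(\mathbf m,\mathbf n)=\det\binom{\mathbf n}{\mathbf m}$ if $\mathbf m\in\Gamma_1$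 and $h(\mathbf m,\mathbf n)=\lambda(\mathbf m,\mathbf n)$ if $\mathbf m\in\Gamma_2$; $g(\mathbf m,\mathbf n)=\lambda(\mathbf m,\mathbf n)$ if $\mathbf m,\mathbf n\in\Gamma_2$ and $g(\mathbf m,\mathbf n)=\det\binom{\mathbf n}{\mathbf m}$ otherwise; with the conventions that the symbols $x^{\mathbf 0}$ and $D(\mathbf 0)$ denote $0$. A transposed Poisson structure on a complex Lie algebra $(L,[\cdot,\cdot])$ is a bilinear, commutative and associative multiplication $\cdot$ on $L$ (no unit required) such that $2z\cdot[x,y]=[z\cdot x,y]+[x,z\cdot y]$ for all $x,y,z\in L$. It is trivial if $x\cdot y=0$ for all $x,y\in L$. *)

(* Defs.v *)
From HB Require Import structures.
From mathcomp Require Import all_boot all_order all_algebra.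
From mathcomp Require Import finmap monalg.
From mathcomp Require Import ring.

Set Implicit Arguments.
Unset Strict Implicit.
Unset Printing Implicit Defensive.

Import GRing.Theory.
Local Open Scope ring_scope.

Record lieAlgebra (K : fieldType) := LieAlgebra {
  lie_sort :> lmodType K;
  lie_br : lie_sort -> lie_sort -> lie_sort;
  lie_bilinear : bilinear_for *:%R *:%R lie_br;
  lie_alternating : forall u, lie_br u u = 0;
  lie_jacobi : forall u v w,
    lie_br u (lie_br v w) + lie_br v (lie_br w u) + lie_br w (lie_br u v) = 0
}.

Record transposed_poisson (K : fieldType) (L : lieAlgebra K)
    (mul : L -> L -> L) : Prop := TransposedPoisson {
  tp_bilinear : bilinear_for *:%R *:%R mul;
  tp_comm : commutative mul;
  tp_assoc : associative mul;
  tp_leibniz : forall x y z,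
    2%:R *: mul z (lie_br x y) = lie_br (mul z x) y + lie_br x (mul z y)
}.

Definition in_tZ2 (t : nat) (m : int * int) : bool :=
  (t%:Z %| m.1)%Z && (t%:Z %| m.2)%Z.

Definition Gamma1 (t : nat) (m : int * int) : bool := in_tZ2 t m && (m != 0).
Definition Gamma2 (t : nat) (m : int * int) : bool := ~~ in_tZ2 t m.

Notation Gamma := {m : int * int | m != 0}.

Section StructureConstants.
Variables (K : fieldType) (t : nat) (q : K).
Implicit Types m n : int * int.

Definition det m n : K := (m.2 * n.1 - m.1 * n.2)%:~R.

Definition lam m n : K := q ^ (m.2 * n.1) - q ^ (m.1 * n.2).

Definition hcoef m n : K := if Gamma1 t m then det m n else lam m n.

Definition gcoef m n : K :=
  if Gamma2 t m && Gamma2 t n then lam m n else det m n.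

End StructureConstants.

(* [inl m] indexes the basis vector x^m, [inr m] the basis vector D(m). *)
Notation qtBasis := (Gamma + Gamma)%type.

Notation qtSpace K := {malg K[qtBasis]}.

(* The value at m = 0, where [insub] fails, is 0. *)
HB.lock Definition xvec (K : fieldType) (m : int * int) : qtSpace K :=
  if insub m is Some m' then << (inl m' : qtBasis) >> else 0.

HB.lock Definition Dvec (K : fieldType) (m : int * int) : qtSpace K :=
  if insub m is Some m' then << (inr m' : qtBasis) >> else 0.

Arguments xvec {K} m.
Arguments Dvec {K} m.

Definition qtbr_basis (K : fieldType) (t : nat) (q : K) (a b : qtBasis) : qtSpace K :=
  match a, b with
  | inl m, inl n => lam q (val m) (val n) *: xvec (val m + val n)
  | inr m, inl n => hcoef t q (val m) (val n) *: xvec (val m + val n)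
  | inl m, inr n => - (hcoef t q (val n) (val m) *: xvec (val n + val m))
  | inr m, inr n => gcoef t q (val m) (val n) *: Dvec (val m + val n)
  end.

HB.lock Definition qtbr (K : fieldType) (t : nat) (q : K)
    (u v : qtSpace K) : qtSpace K :=
  \sum_(a <- msupp u) \sum_(b <- msupp v)
    (u@_a * v@_b) *: qtbr_basis t q a b.

Section Bracket.
Variables (K : fieldType) (t : nat) (q : K).

Local Notation qtbr := (qtbr t q).
Local Notation qtbr_basis := (qtbr_basis t q).

Lemma qtbrEw (d1 d2 : {fset qtBasis}) u v :
    (msupp u `<=` d1)%fset -> (msupp v `<=` d2)%fset ->
  qtbr u v = \sum_(a <- d1) \sum_(b <- d2) (u@_a * v@_b) *: qtbr_basis a b.
Proof.
move=> s1 s2; rewrite qtbr.unlock.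
have in2 a : \sum_(b <- msupp v) (u@_a * v@_b) *: qtbr_basis a b =
             \sum_(b <- d2) (u@_a * v@_b) *: qtbr_basis a b.
  apply: big_fset_incl => // b _ nb.
  by rewrite (mcoeff_outdom nb) mulr0 scale0r.
under eq_bigr => a _ do rewrite in2.
apply: big_fset_incl => // a _ na.
by rewrite big1 // => b _; rewrite (mcoeff_outdom na) mul0r scale0r.
Qed.

Lemma qtbr_linear1 w : linear (qtbr^~ w).
Proof.
move=> c u v.
set d := (msupp u `|` msupp v `|` msupp (c *: u + v))%fset.
have Hu : (msupp u `<=` d)%fset by rewrite /d -fsetUA fsubsetUl.
have Hv : (msupp v `<=` d)%fset by rewrite /d fsetUAC fsubsetUr.
have Hc : (msupp (c *: u + v) `<=` d)%fset by rewrite /d fsubsetUr.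
rewrite (qtbrEw Hu (fsubset_refl _)) (qtbrEw Hv (fsubset_refl _)).
rewrite (qtbrEw Hc (fsubset_refl _)) scaler_sumr -big_split /=.
apply: eq_bigr => a _; rewrite scaler_sumr -big_split /=.
apply: eq_bigr => b _.
by rewrite mcoeffD mcoeffZ mulrDl scalerDl -mulrA scalerA.
Qed.

Lemma qtbr_linear2 w : linear (qtbr w).
Proof.
move=> c u v.
set d := (msupp u `|` msupp v `|` msupp (c *: u + v))%fset.
have Hu : (msupp u `<=` d)%fset by rewrite /d -fsetUA fsubsetUl.
have Hv : (msupp v `<=` d)%fset by rewrite /d fsetUAC fsubsetUr.
have Hc : (msupp (c *: u + v) `<=` d)%fset by rewrite /d fsubsetUr.
rewrite (qtbrEw (fsubset_refl _) Hu) (qtbrEw (fsubset_refl _) Hv).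
rewrite (qtbrEw (fsubset_refl _) Hc) scaler_sumr -big_split /=.
apply: eq_bigr => a _; rewrite scaler_sumr -big_split /=.
apply: eq_bigr => b _.
by rewrite mcoeffD mcoeffZ mulrDr scalerDl mulrCA scalerA.
Qed.

Lemma qtbr_bilinear : bilinear_for *:%R *:%R qtbr.
Proof. by split=> w; [exact: qtbr_linear1 | exact: qtbr_linear2]. Qed.

HB.instance Definition _ :=
  bilinear_isBilinear.Build K (qtSpace K) (qtSpace K) (qtSpace K)
    *:%R *:%R qtbr qtbr_bilinear.

Lemma qtbrUU a b : qtbr << a >> << b >> = qtbr_basis a b.
Proof.
rewrite (qtbrEw (msuppU_le (k := a)) (msuppU_le (k := b))).
by rewrite !big_seq_fset1 !mcoeffUU mulr1 scale1r.
Qed.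

Lemma xvec0 : xvec 0 = 0 :> qtSpace K.
Proof. by rewrite xvec.unlock insubF // eqxx. Qed.

Lemma Dvec0 : Dvec 0 = 0 :> qtSpace K.
Proof. by rewrite Dvec.unlock insubF // eqxx. Qed.

Lemma lam0l n : lam q 0 n = 0.
Proof. by rewrite /lam /= !mul0r subrr. Qed.

Lemma lam0r m : lam q m 0 = 0.
Proof. by rewrite /lam /= !mulr0 subrr. Qed.

Lemma det0l n : det K 0 n = 0.
Proof. by rewrite /det /= !mul0r subrr. Qed.

Lemma det0r m : det K m 0 = 0.
Proof. by rewrite /det /= !mulr0 subrr. Qed.

Lemma hcoef0l n : hcoef t q 0 n = 0.
Proof. by rewrite /hcoef lam0l det0l if_same. Qed.

Lemma hcoef0r m : hcoef t q m 0 = 0.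
Proof. by rewrite /hcoef lam0r det0r if_same. Qed.

Lemma gcoef0l n : gcoef t q 0 n = 0.
Proof. by rewrite /gcoef lam0l det0l if_same. Qed.

Lemma gcoef0r m : gcoef t q m 0 = 0.
Proof. by rewrite /gcoef lam0r det0r if_same. Qed.

Lemma vecP m : m = 0 \/ exists m' : Gamma,
  [/\ m = val m', xvec m = << (inl m' : qtBasis) >> :> qtSpace K
    & Dvec m = << (inr m' : qtBasis) >> :> qtSpace K].
Proof.
have [->|m0] := eqVneq m 0; [by left | right].
by exists (exist _ m m0); split=> //; rewrite ?xvec.unlock ?Dvec.unlock insubT.
Qed.

(* The defining relations hold for all indices in Z^2: the structure constants
   vanish when an index is 0, matching x^0 = D(0) = 0. *)
Lemma qtbr_xx m n : qtbr (xvec m) (xvec n) = lam q m n *: xvec (m + n).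
Proof.
case: (vecP m) => [->|[m' [em xm _]]].
  by rewrite xvec0 linear0l lam0l scale0r.
case: (vecP n) => [->|[n' [en xn _]]].
  by rewrite xvec0 linear0r lam0r scale0r.
by rewrite xm xn qtbrUU /= em en.
Qed.

Lemma qtbr_Dx m n : qtbr (Dvec m) (xvec n) = hcoef t q m n *: xvec (m + n).
Proof.
case: (vecP m) => [->|[m' [em _ Dm]]].
  by rewrite Dvec0 linear0l hcoef0l scale0r.
case: (vecP n) => [->|[n' [en xn _]]].
  by rewrite xvec0 linear0r hcoef0r scale0r.
by rewrite Dm xn qtbrUU /= em en.
Qed.

Lemma qtbr_xD m n : qtbr (xvec m) (Dvec n) = - (hcoef t q n m *: xvec (n + m)).
Proof.
case: (vecP m) => [->|[m' [em xm _]]].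
  by rewrite xvec0 linear0l hcoef0r scale0r oppr0.
case: (vecP n) => [->|[n' [en _ Dn]]].
  by rewrite Dvec0 linear0r hcoef0l scale0r oppr0.
by rewrite xm Dn qtbrUU /= em en.
Qed.

Lemma qtbr_DD m n : qtbr (Dvec m) (Dvec n) = gcoef t q m n *: Dvec (m + n).
Proof.
case: (vecP m) => [->|[m' [em _ Dm]]].
  by rewrite Dvec0 linear0l gcoef0l scale0r.
case: (vecP n) => [->|[n' [en _ Dn]]].
  by rewrite Dvec0 linear0r gcoef0r scale0r.
by rewrite Dm Dn qtbrUU /= em en.
Qed.


Lemma lam_anti m n : lam q n m = - lam q m n.
Proof. by rewrite /lam opprB [m.2 * _]mulrC [m.1 * _]mulrC. Qed.

Lemma det_anti m n : det K n m = - det K m n.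
Proof. by rewrite /det -rmorphN opprB [m.2 * _]mulrC [m.1 * _]mulrC. Qed.

Lemma gcoef_anti m n : gcoef t q n m = - gcoef t q m n.
Proof. by rewrite /gcoef andbC; case: ifP; rewrite (lam_anti, det_anti). Qed.

Lemma qtbr_basis_anti a b : qtbr_basis b a = - qtbr_basis a b.
Proof.
case: a b => [m|m] [n|n] /=; rewrite ?opprK //.
- by rewrite lam_anti addrC scaleNr.
- by rewrite gcoef_anti addrC scaleNr.
Qed.

Lemma qtbr_anti u v : qtbr v u = - qtbr u v.
Proof.
rewrite qtbr.unlock exchange_big -sumrN; apply: eq_bigr => a _.
rewrite -sumrN; apply: eq_bigr => b _.
by rewrite mulrC qtbr_basis_anti scalerN.
Qed.

Lemma qt_ind (P : qtSpace K -> Prop) :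
    P 0 -> (forall c u v, P u -> P v -> P (c *: u + v)) ->
    (forall m, P (xvec m)) -> (forall m, P (Dvec m)) ->
  forall u, P u.
Proof.
move=> P0 PL Px PD u.
have PB a : P << a >>.
  case: a => m; [have := Px (val m) | have := PD (val m)];
  by rewrite ?xvec.unlock ?Dvec.unlock valK.
rewrite [u]monalgE; elim: (enum_fset _) => [|a s IH].
  by rewrite big_nil.
rewrite big_cons; have -> : << u@_a *g a >> = u@_a *: << a >> :> qtSpace K.
  by apply/malgP => k; rewrite mcoeffZ !mcoeffU mulrnAr mulr1.
exact: PL.
Qed.

Lemma qtbr_alternating u : qtbr u u = 0.
Proof.
have lam_id m : lam q m m = 0 by rewrite /lam mulrC subrr.
have det_id m : det K m m = 0 by rewrite /det mulrC subrr.
elim/qt_ind: u => [|c u v Hu Hv|m|m].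
- exact: linear0l.
- rewrite !linearDl !linearDr !linearZl_LR !linearZr_LR /= Hu Hv (qtbr_anti u v).
  by rewrite !scaler0 add0r addr0 scalerN subrr.
- by rewrite qtbr_xx lam_id scale0r.
- by rewrite qtbr_DD /gcoef lam_id det_id if_same scale0r.
Qed.

End Bracket.

Section Jacobi.
Variables (K : fieldType) (t : nat) (q : K).
Hypothesis q_prim : t.-primitive_root q.
Implicit Types m n p : int * int.

Local Notation P m n := (q ^ (m.2 * n.1)).
Local Notation lam := (lam q).
Local Notation det := (det K).
Local Notation hcoef := (hcoef t q).
Local Notation gcoef := (gcoef t q).
Local Notation inT := (in_tZ2 t).

Let q_neq0 : q != 0.
Proof.
have /eqP := prim_expr_order q_prim; apply: contraTneq => ->.
by rewrite expr0n gtn_eqF ?(prim_order_gt0 q_prim) // eq_sym oner_eq0.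
Qed.

Let lamE m n : lam m n = P m n - P n m.
Proof. by rewrite /Defs.lam [m.1 * _]mulrC. Qed.

Let detE m n : det m n = m.2%:~R * n.1%:~R - m.1%:~R * n.2%:~R.
Proof. by rewrite /Defs.det rmorphB !rmorphM. Qed.

Let detDl m n p : det (m + n) p = det m p + det n p.
Proof. by rewrite !detE /= !rmorphD /=; ring. Qed.

Let detDr m n p : det p (m + n) = det p m + det p n.
Proof. by rewrite !detE /= !rmorphD /=; ring. Qed.

Let PDl m n p : P (m + n) p = P m p * P n p.
Proof. by rewrite mulrDl expfzDr. Qed.

Let PDr m n p : P p (m + n) = P p m * P p n.
Proof. by rewrite mulrDr expfzDr. Qed.

Let q_dvd (a b : int) : (t%:Z %| a)%Z -> q ^ (a * b) = 1.
Proof.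
case/dvdzP=> c ->; rewrite mulrAC mulrC -exprz_exp.
by rewrite -exprnP (prim_expr_order q_prim) exp1rz.
Qed.

Let PTl m n : inT m -> P m n = 1.
Proof. by case/andP=> _ /q_dvd ->. Qed.

Let PTr m n : inT n -> P m n = 1.
Proof. by case/andP=> d _; rewrite mulrC q_dvd. Qed.

Let inTD m n : inT m -> inT (m + n) = inT n.
Proof.
by case/andP=> d1 d2; rewrite /in_tZ2 /= (rpredDl _ d1) (rpredDl _ d2).
Qed.

Let inT0 : inT 0.
Proof. by rewrite /in_tZ2 /= !dvdz0. Qed.

Let hcoefE m n : hcoef m n = if inT m then det m n else lam m n.
Proof.
rewrite /Defs.hcoef /Gamma1; case: eqVneq => [->|_]; last by rewrite andbT.
by rewrite andbF inT0 lam0l det0l.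
Qed.

Let gcoefE m n : gcoef m n = if inT m || inT n then det m n else lam m n.
Proof. by rewrite /Defs.gcoef /Gamma2 -negb_or; case: (_ || _). Qed.

Let lamDT m n : inT (m + n) -> lam m n = 0.
Proof.
move=> T; rewrite lamE; have e : n = (m + n) - m by rewrite addrC addKr.
have PN a b : P (- a) b = (P a b)^-1 by rewrite /= mulNr -invr_expz.
have PN' a b : P b (- a) = (P b a)^-1 by rewrite /= mulrN -invr_expz.
by rewrite {1 2}e PDl PDr (PTl _ T) (PTr _ T) PN PN' subrr.
Qed.

Let lamSl k m n : inT k -> lam (k + m) n = lam m n.
Proof. by move=> T; rewrite !lamE PDl PDr (PTl _ T) (PTr _ T) !mul1r. Qed.

Let lamSr k m n : inT k -> lam m (k + n) = lam m n.
Proof. by move=> T; rewrite !lamE PDl PDr (PTl _ T) (PTr _ T) !mul1r. Qed.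

Let lam_jacobi m n p :
  lam n p * lam m (n + p) + lam p m * lam n (p + m) + lam m n * lam p (m + n)
  = 0.
Proof. by rewrite !lamE !PDl !PDr; ring. Qed.

Let det_jacobi m n p :
  det n p * det m (n + p) + det p m * det n (p + m) + det m n * det p (m + n)
  = 0.
Proof. by rewrite !detE /= !rmorphD /=; ring. Qed.

Let hxx m n p :
  lam n p * hcoef m (n + p) - hcoef m p * lam n (m + p)
    + hcoef m n * lam p (m + n) = 0.
Proof.
rewrite !hcoefE; case: ifP => T.
  by rewrite !lamSr // (lam_anti _ n p) detDr; ring.
by rewrite -[RHS](lam_jacobi m n p) (lam_anti _ m p) (addrC p m); ring.
Qed.

Let hhx m n p :
  hcoef n p * hcoef m (n + p) - hcoef m p * hcoef n (m + p)
    - gcoef m n * hcoef (m + n) p = 0.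
Proof.
rewrite !hcoefE gcoefE; have [mT|mF] := boolP (inT m); have [nT|nF] := boolP (inT n).
- rewrite inTD // nT /= -[RHS](det_jacobi m n p).
  by rewrite (det_anti _ m p) (det_anti _ (m + n) p) (addrC p m); ring.
- rewrite inTD // (negPf nF) /= lamSr // lamSl // !detDr; ring.
- rewrite (addrC m n) inTD // (negPf mF) /= lamSr // lamSl //.
  by rewrite !detDr (det_anti _ m n); ring.
- have -> : lam m n * (if inT (m + n) then det (m + n) p else lam (m + n) p)
            = lam m n * lam (m + n) p.
    by case: ifP => // T; rewrite lamDT // !mul0r.
  rewrite -[RHS](lam_jacobi m n p) /=.
  by rewrite (lam_anti _ m p) (lam_anti _ (m + n) p) (addrC p m); ring.
Qed.

Let ggg1 m n p : inT m ->
  gcoef n p * gcoef m (n + p) + gcoef p m * gcoef n (p + m)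
    + gcoef m n * gcoef p (m + n) = 0.
Proof.
move=> mT; rewrite !gcoefE mT orbT /= (addrC p m) !inTD // (orbC (inT p)).
case: ifP => _; first by rewrite -[RHS](det_jacobi m n p) (addrC p m).
rewrite !lamSr // (lam_anti _ n p) (det_anti _ m p) detDr; ring.
Qed.

Let ggg m n p :
  gcoef n p * gcoef m (n + p) + gcoef p m * gcoef n (p + m)
    + gcoef m n * gcoef p (m + n) = 0.
Proof.
have [mT|mF] := boolP (inT m); first exact: ggg1.
have [nT|nF] := boolP (inT n); first by rewrite -addrA addrC; exact: ggg1.
have [pT|pF] := boolP (inT p); first by rewrite addrC addrA; exact: ggg1.
have E a b c : ~~ inT a -> ~~ inT b -> ~~ inT c ->
    gcoef b c * gcoef a (b + c) = lam b c * lam a (b + c).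
  move=> /negPf aF /negPf bF /negPf cF; rewrite !gcoefE aF bF cF /=.
  by case: ifP => // T; rewrite lamDT // !mul0r.
by rewrite !E // lam_jacobi.
Qed.

Local Notation br := (qtbr t q).
Local Notation J u v w := (br u (br v w) + br v (br w u) + br w (br u v)).
Local Notation x := (@xvec K).
Local Notation D := (@Dvec K).

Let brZr c u v : br u (c *: v) = c *: br u v.
Proof. exact: linearZr_LR. Qed.

Let brNr u v : br u (- v) = - br u v.
Proof. exact: linearNr. Qed.

Let brE := (brZr, brNr, qtbr_xx, qtbr_Dx, qtbr_xD, qtbr_DD, @scalerN K (qtSpace K),
  @opprK (qtSpace K), @scalerA K (qtSpace K)).

Let addE m n p :
  (n + (p + m) = m + (n + p)) * (n + (m + p) = m + (n + p))
  * (p + (m + n) = m + (n + p)) * (m + n + p = m + (n + p)).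
Proof.
by do !split; rewrite ?(addrC p) ?addrA // (addrC n m).
Qed.

Let vecE (V : Type) (f : int * int -> V) m n p :
  (f (n + (p + m)) = f (m + (n + p))) * (f (n + (m + p)) = f (m + (n + p)))
  * (f (p + (m + n)) = f (m + (n + p))) * (f (m + n + p) = f (m + (n + p))).
Proof. by rewrite !(addE m n p). Qed.

Let Jxxx m n p : J (x m) (x n) (x p) = 0.
Proof.
rewrite !brE !(vecE (@xvec K) m n p) -!scalerDl.
by rewrite lam_jacobi scale0r.
Qed.

Let scaleBD (a b c : K) (v : qtSpace K) :
  a *: v - b *: v + c *: v = (a - b + c) *: v.
Proof. by rewrite scalerDl scalerBl. Qed.

Let scaleBB (a b c : K) (v : qtSpace K) :
  a *: v - b *: v - c *: v = (a - b - c) *: v.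
Proof. by rewrite !scalerBl. Qed.

Let JDxx m n p : J (D m) (x n) (x p) = 0.
Proof. by rewrite !brE !(vecE (@xvec K) m n p) scaleBD hxx scale0r. Qed.

Let JDDx m n p : J (D m) (D n) (x p) = 0.
Proof. by rewrite !brE !(vecE (@xvec K) m n p) scaleBB hhx scale0r. Qed.

Let JDDD m n p : J (D m) (D n) (D p) = 0.
Proof.
rewrite !brE !(vecE (@Dvec K) m n p) -!scalerDl.
by rewrite ggg scale0r.
Qed.

Let JC u v w : J u v w = J v w u.
Proof. by rewrite [RHS]addrC addrA. Qed.

Let J0 v w : J 0 v w = 0.
Proof. by rewrite !(linear0l, linear0r) !addr0. Qed.

Let comb3 (V : lmodType K) c (a a' b b' d d' : V) :
  (c *: a + a') + (c *: b + b') + (c *: d + d')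
  = c *: (a + b + d) + (a' + b' + d').
Proof. by rewrite (addrACA (c *: a)) (addrACA (_ + _)) -!scalerDr. Qed.

Let comb0 (V : lmodType K) c (a b : V) : a = 0 -> b = 0 -> c *: a + b = 0.
Proof. by move=> -> ->; rewrite scaler0 addr0. Qed.

Let brPl c u u' v : br (c *: u + u') v = c *: br u v + br u' v.
Proof. exact: qtbr_linear1. Qed.

Let brPr c u u' v : br v (c *: u + u') = c *: br v u + br v u'.
Proof. exact: qtbr_linear2. Qed.

Let JL c u u' v w : J u v w = 0 -> J u' v w = 0 -> J (c *: u + u') v w = 0.
Proof.
move=> Ju Ju'; rewrite brPl (brPr _ _ _ w) brPr (brPl _ _ _ v) brPr comb3.
exact: comb0.
Qed.

Let isB u := (exists m, u = x m) \/ (exists m, u = D m).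

Let Jbas u v w : isB u -> isB v -> isB w -> J u v w = 0.
Proof.
case=> -[m ->]; case=> -[n ->]; case=> -[p ->].
- exact: Jxxx.
- by rewrite JC JC; exact: JDxx.
- by rewrite JC; exact: JDxx.
- by rewrite JC; exact: JDDx.
- exact: JDxx.
- by rewrite JC JC; exact: JDDx.
- exact: JDDx.
- exact: JDDD.
Qed.

Let Jext v w : (forall u, isB u -> J u v w = 0) -> forall u, J u v w = 0.
Proof.
move=> HB; apply: qt_ind => [|c u u'|m|m]; [exact: J0 | exact: JL | |].
- by apply: HB; left; exists m.
- by apply: HB; right; exists m.
Qed.

Lemma qtbr_jacobi u v w : J u v w = 0.
Proof.
apply: Jext u => u Bu; rewrite JC; apply: Jext v => v Bv; rewrite JC.
by apply: Jext w => w Bw; rewrite JC; exact: Jbas.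
Qed.

End Jacobi.

Definition qtorus (K : fieldType) (t : nat) (q : K)
    (q_prim : t.-primitive_root q) : lieAlgebra K :=
  LieAlgebra (qtbr_bilinear t q) (qtbr_alternating t q) (qtbr_jacobi q_prim).

(* Main.v *)
Require Import Defs.
From mathcomp Require Import all_boot all_order all_algebra.
From mathcomp Require Import reals complex monalg ring zify.

Set Implicit Arguments.
Unset Strict Implicit.
Unset Printing Implicit Defensive.

Import Order.TTheory GRing.Theory Num.Theory.
Local Open Scope ring_scope.

(** For a fixed z the multiplication phi = mul z is a half-derivation:
    2 phi [u, v] = [phi u, v] + [u, phi v].  Write T = (tZ)^2.  For m in T the
    element D(m) acts on every basis vector of degree n by the scalar det m n
    and a shift by m, so the half-derivation identity for D(m) and a basis
    vector is a recursion along the coset n + T for each coefficient of phi.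

    Acting by D(m) before phi gives a scalar that depends on the source degree,
    acting after phi one that depends on the target degree.  Both degrees move
    together along the coset, but only the first scalar carries the factor 2;
    [recursion_eq0] turns this mismatch into vanishing of the coefficient, as
    soon as the remaining term [phi D(m), _] only contributes l * e m, with l
    constant and e compatible with doubling.

    The Lie algebra is (A + A' + C) x| H, where A, A' and C are pairwise
    commuting ideals spanned by the x^n with n outside T, the D(n) - x^n with n
    outside T, and the x^n with n in T, while H is spanned by the D(n) with n in
    T.  The recursion first shows that every mul z preserves A ([cf_mul_x]), so for
    z in A the elements z * D(m) lie in A, whence A * A = 0 ([mul_xx]).  As A has
    trivial centre, A annihilates everything ([mul_x_Gamma2]), so that every
    product centralises A, i.e. lies in A' + C ([cf_true_mul_T],
    [cf_false_mul_Gamma2]).  The recursion then applies to A' and C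
    ([mul_D_Gamma2], [mul_x_T]).

    Only H * H, contained in C, remains, and there half-derivations do not force
    vanishing: D(m) |-> x^m for m in T, extended by zero, is a half-derivation.
    On H it is however the only one with values in C, up to scalars
    ([recursion_shift_eq0], [recursion_const]).  So D(m) * D(n) is a multiple of
    x^n with a factor independent of n, and by commutativity a multiple of x^m;
    it is therefore zero ([mul_DD_T]). *)

(** * The sublattice T and recursions along its cosets *)

Section Lattice.
Variables (K : numFieldType) (t : nat).
Hypothesis t_gt0 : (0 < t)%N.
Implicit Types m n r s w : int * int.
Local Notation inT := (in_tZ2 t).
Local Notation det := (det K).

Lemma in_tZ2_0 : inT 0.
Proof. by rewrite /in_tZ2 !dvdz0. Qed.

Lemma in_tZ2Dl m n : inT m -> inT (m + n) = inT n.
Proof.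
by case/andP=> m1 m2; rewrite /in_tZ2 /= (rpredDl _ m1) (rpredDl _ m2).
Qed.

Lemma in_tZ2N m : inT (- m) = inT m.
Proof. by rewrite /in_tZ2 /= !rpredN. Qed.

Lemma in_tZ2Dr m n : inT m -> inT (n + m) = inT n.
Proof. by move=> mT; rewrite addrC in_tZ2Dl. Qed.

Lemma in_tZ2_neq0 m : ~~ inT m -> m != 0.
Proof. by apply: contraNneq => ->; exact: in_tZ2_0. Qed.

Lemma detE m n : det m n = m.2%:~R * n.1%:~R - m.1%:~R * n.2%:~R.
Proof. by rewrite /Defs.det rmorphB !rmorphM. Qed.

Lemma detDl m n r : det (m + n) r = det m r + det n r.
Proof. by rewrite !detE /= !rmorphD /=; ring. Qed.

Lemma detDr r m n : det r (m + n) = det r m + det r n.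
Proof. by rewrite !detE /= !rmorphD /=; ring. Qed.

Lemma detNr r m : det r (- m) = - det r m.
Proof. by rewrite !detE /= !rmorphN /=; ring. Qed.

Lemma detmm m : det m m = 0.
Proof. by rewrite detE mulrC subrr. Qed.

Lemma generic_int_neq0 (a b N j k : int) : (a != 0) || (b != 0) ->
  0 < j -> 0 < k <= 2 -> 2 * `|b| < N -> j * N * a - k * b != 0.
Proof.
move=> ab j0 /andP[k0 k2] bN; have [a0|a0] := eqVneq a 0.
  move: ab; rewrite a0 eqxx /= => b0.
  by rewrite mulr0 sub0r oppr_eq0 mulf_neq0 // gt_eqF.
have N0 : 0 < N by apply: le_lt_trans bN; rewrite mulr_ge0.
rewrite subr_eq0; apply/eqP => E; move: bN; apply/negP; rewrite -leNgt.
have {}E : j * N * `|a| = k * `|b|.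
  by move: (congr1 Num.norm E); rewrite !normrM (gtr0_norm j0) (gtr0_norm N0) (gtr0_norm k0).
apply: le_trans (_ : k * `|b| <= _); last exact: ler_wpM2r.
rewrite -E mulrAC ler_peMl ?(ltW N0) // -[1]mulr1 ler_pM //; lia.
Qed.

(** The conditions exclude finitely many lines through the origin, so the
    witnesses are taken on two steep lines, of slopes N and 2 N, with N large
    compared to s and w. *)
Lemma generic_pair s w : s != 0 -> w != 0 -> exists m n,
  [/\ inT m, inT n, det m n != 0,
      [&& det m s != 0, det n s != 0 & det (m + n) s != 0]
    & [&& det m w != 0, det n w != 0 & det (m + n) w != 0]].
Proof.
move=> s0 w0; pose N := 1 + 2 * `|s.2| + 2 * `|w.2| : int.
have pairN0 r : r != 0 -> (r.1 != 0) || (r.2 != 0).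
  by case: r => a b; rewrite xpair_eqE negb_and.
have T0 : t%:Z != 0 by rewrite eqz_nat -lt0n.
have G r : r != 0 -> 2 * `|r.2| < N ->
    [&& det (t%:Z, t%:Z * N) r != 0, det (t%:Z, t%:Z * (2 * N)) r != 0
      & det ((t%:Z, t%:Z * N) + (t%:Z, t%:Z * (2 * N))) r != 0].
  move=> /pairN0 r0 rN; rewrite /Defs.det !intr_eq0 /=.
  have F j k : 0 < j -> 0 < k <= 2 -> t%:Z * (j * N * r.1 - k * r.2) != 0.
    by move=> j0 k0; rewrite mulf_neq0 // generic_int_neq0.
  apply/and3P; split.
  - by have := F 1 1 isT isT; congr (_ != 0); ring.
  - by have := F 2 1 isT isT; congr (_ != 0); ring.
  - by have := F 3 2 isT isT; congr (_ != 0); ring.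
exists (t%:Z, t%:Z * N), (t%:Z, t%:Z * (2 * N)); split.
- by rewrite /in_tZ2 /= dvdzz dvdz_mulr.
- by rewrite /in_tZ2 /= dvdzz dvdz_mulr.
- rewrite /Defs.det intr_eq0 /=.
  have -> : t%:Z * N * t - t%:Z * (t%:Z * (2 * N)) = - (t%:Z * t%:Z * N) by ring.
  by rewrite oppr_eq0 !mulf_neq0 // /N; lia.
- by apply: G => //; rewrite /N; lia.
- by apply: G => //; rewrite /N; lia.
Qed.

(** The equation for 2 m can be reached directly or in two steps of m; comparing
    the two shows F m = F 0 for generic m.  With F constant, the two sides of the
    recursion grow differently when the base point moves from 0 to m', and the
    discrepancy is det m m' * F 0.  The vector w only serves to restrict the
    doubling law of e to generic m; any nonzero w does when l = 0. *)
Lemma recursion_eq0 (F e : int * int -> K) (l : K) n s w :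
    s != 0 -> w != 0 ->
    (forall m m', inT m -> inT m' ->
       2 * det m (n + m') * F (m + m') = l * e m + det m (s + m') * F m') ->
    (forall m, inT m -> det m w != 0 -> l * e (m + m) = 2 * (l * e m)) ->
  F 0 = 0.
Proof.
move=> s0 w0 rec e2.
have constF m : inT m -> det m s != 0 -> det m w != 0 -> F m = F 0.
  move=> mT ms mw.
  have m2T : inT (m + m) by rewrite in_tZ2Dl.
  have A := rec _ _ m2T in_tZ2_0; have B := rec _ _ mT mT.
  rewrite !addr0 e2 // !detDl in A; rewrite !detDr detmm !addr0 in B.
  have : (2 * det m s) * (F m - F 0) = 0.
    transitivity (2 * (2 * det m n * F (m + m))
      - 2 * (det m n + det m n) * F (m + m)); last by ring.
    by rewrite A B; ring.
  by move/eqP; rewrite !mulf_eq0 pnatr_eq0 (negPf ms) subr_eq0 => /eqP.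
have [m [m' [mT mT' mm' /and3P[ms ms' mms] /and3P[mw mw' mmw]]]] :=
  generic_pair s0 w0.
have mmT : inT (m + m') by rewrite in_tZ2Dl.
have A := rec _ _ mT in_tZ2_0; have B := rec _ _ mT mT'.
rewrite !addr0 constF // in A.
rewrite !detDr !constF // in B.
have : det m m' * F 0 = 0.
  transitivity (2 * (det m n + det m m') * F 0 - 2 * det m n * F 0 - det m m' * F 0).
    by ring.
  by rewrite A B; ring.
by move/eqP; rewrite mulf_eq0 (negPf mm') => /eqP.
Qed.

End Lattice.

(** * Structure constants *)

Section QuantumTorus.
Variables (K : numFieldType) (t : nat) (q : K).
Hypothesis q_prim : t.-primitive_root q.
Implicit Types m n k r s : int * int.
Local Notation inT := (in_tZ2 t).
Local Notation det := (det K).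
Local Notation lam := (lam q).
Local Notation hcoef := (hcoef t q).
Local Notation gcoef := (gcoef t q).
Local Notation br := (qtbr t q).

Lemma prim_root_neq0 : q != 0.
Proof.
have /eqP := prim_expr_order q_prim; apply: contraTneq => ->.
by rewrite expr0n gtn_eqF ?(prim_order_gt0 q_prim) // eq_sym oner_eq0.
Qed.

Lemma exprz_eq1 (a : int) : (q ^ a == 1) = (t%:Z %| a)%Z.
Proof.
rewrite dvdzE; case: a => a; first by rewrite -exprnP (prim_order_dvd q_prim).
by rewrite NegzE -invr_expz invr_eq1 -exprnP (prim_order_dvd q_prim).
Qed.

Lemma exprzD_dvd (a b : int) : (t%:Z %| b)%Z -> q ^ (a + b) = q ^ a.
Proof.
by rewrite -exprz_eq1 expfzDr ?prim_root_neq0 // => /eqP ->; rewrite mulr1.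
Qed.

Lemma lam_eq0 m n : (lam m n == 0) = (t%:Z %| m.2 * n.1 - m.1 * n.2)%Z.
Proof.
rewrite /Defs.lam -exprz_eq1; set a := m.2 * _; set b := m.1 * _.
have -> : q ^ a = q ^ (a - b) * q ^ b by rewrite -expfzDr ?prim_root_neq0 ?subrK.
rewrite -{2}[q ^ b]mul1r subr_eq0 (inj_eq (mulIf _)) //.
by rewrite expfz_neq0 ?prim_root_neq0.
Qed.

Lemma lam_Tl m n : inT m -> lam m n = 0.
Proof.
by case/andP=> m1 m2; apply/eqP; rewrite lam_eq0 rpredB // dvdz_mulr.
Qed.

Lemma lam_Tr m n : inT n -> lam m n = 0.
Proof. by move=> nT; rewrite lam_anti lam_Tl ?oppr0. Qed.

Lemma lamDl m n k : inT k -> lam (m + k) n = lam m n.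
Proof.
by case/andP=> k1 k2; rewrite /Defs.lam /= !mulrDl !exprzD_dvd // dvdz_mulr.
Qed.

Lemma lamDr m n k : inT k -> lam m (n + k) = lam m n.
Proof. by move=> kT; rewrite lam_anti lamDl // -lam_anti. Qed.

Lemma lammm m : lam m m = 0.
Proof. by rewrite /Defs.lam mulrC subrr. Qed.

Lemma lamNr m n : lam m n = 0 -> lam m (- n) = 0.
Proof.
move/eqP; rewrite lam_eq0 => d; apply/eqP.
by rewrite lam_eq0 /= !mulrN -opprD rpredN.
Qed.

Lemma lam_TD m n : inT (m + n) -> lam m n = 0.
Proof.
by move=> T; rewrite -[n](addKr m) lamDr // lamNr ?lammm.
Qed.

Lemma hcoefE m n : hcoef m n = if inT m then det m n else lam m n.
Proof.
rewrite /Defs.hcoef /Gamma1; case: eqVneq => [->|_]; last by rewrite andbT.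
by rewrite andbF in_tZ2_0 lam0l det0l.
Qed.

Lemma gcoefE m n : gcoef m n = if inT m || inT n then det m n else lam m n.
Proof. by rewrite /Defs.gcoef /Gamma2 -negb_or; case: (_ || _). Qed.

Lemma hcoef_T m n : inT m -> hcoef m n = det m n.
Proof. by move=> mT; rewrite hcoefE mT. Qed.

Lemma gcoef_T m n : inT m -> gcoef m n = det m n.
Proof. by move=> mT; rewrite gcoefE mT. Qed.

Lemma hcoefmN m : hcoef m (- m) = 0.
Proof. by rewrite hcoefE detNr detmm oppr0 lamNr ?lammm ?if_same. Qed.

Lemma gcoefmN m : gcoef m (- m) = 0.
Proof. by rewrite gcoefE detNr detmm oppr0 lamNr ?lammm ?if_same. Qed.

Lemma lam_neq0_ex (t_gt1 : (1 < t)%N) k : ~~ inT k -> exists n,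
  [/\ ~~ inT n & lam k n != 0].
Proof.
have t1 : ~~ (t%:Z %| 1)%Z by rewrite dvdz1 /= eqn_leq leqNgt t_gt1.
rewrite negb_and => /orP[k1|k2].
- exists (0, 1); rewrite lam_eq0 /in_tZ2 /= (negPf t1) andbF.
  by rewrite mulr0 mulr1 sub0r rpredN.
- exists (1, 0); rewrite lam_eq0 /in_tZ2 /= (negPf t1).
  by rewrite mulr0 mulr1 subr0.
Qed.

Lemma det_neq0_ex (t_gt1 : (1 < t)%N) k : k != 0 -> exists n,
  [/\ ~~ inT n & det k n != 0].
Proof.
have t1 : ~~ (t%:Z %| 1)%Z by rewrite dvdz1 /= eqn_leq leqNgt t_gt1.
case: k => k1 k2; rewrite xpair_eqE negb_and => /orP[k10|k20].
- exists (0, 1); rewrite /Defs.det /in_tZ2 /= (negPf t1) andbF intr_eq0.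
  by rewrite mulr0 mulr1 sub0r oppr_eq0.
- exists (1, 0); rewrite /Defs.det /in_tZ2 /= (negPf t1) intr_eq0.
  by rewrite mulr0 mulr1 subr0.
Qed.

(** * Coefficients of a bracket *)

Definition bvec (b : bool) m : qtSpace K := if b then Dvec m else xvec m.

(** At s = 0 there is no basis vector and the coefficient is 0, in accordance
    with x^0 = D(0) = 0; thus the bracket formulas below need no side condition
    on degrees. *)
Definition cf (b : bool) s (u : qtSpace K) : K :=
  if insub s is Some s' then u@_(if b then inr s' else inl s') else 0.

Lemma cfD b s u v : cf b s (u + v) = cf b s u + cf b s v.
Proof. by rewrite /cf; case: insub => [s'|]; rewrite ?mcoeffD ?addr0. Qed.

Lemma cfZ b s c u : cf b s (c *: u) = c * cf b s u.
Proof. by rewrite /cf; case: insub => [s'|]; rewrite ?mcoeffZ ?mulr0. Qed.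

Lemma cf0 b s : cf b s 0 = 0.
Proof. by rewrite -(scale0r 0) cfZ mul0r. Qed.

Lemma cfN b s u : cf b s (- u) = - cf b s u.
Proof. by rewrite -scaleN1r cfZ mulN1r. Qed.

Lemma cf_at0 b u : cf b 0 u = 0.
Proof. by rewrite /cf insubF // eqxx. Qed.

Lemma cf_bvec b s b' n :
  cf b s (bvec b' n) = ((b == b') && (s == n) && (s != 0))%:R.
Proof.
have [->|s0] := eqVneq s 0; first by rewrite cf_at0 andbF.
rewrite andbT /cf insubT /bvec; case: (vecP K n) => [->|[n' [-> -> ->]]].
  by rewrite xvec0 Dvec0 if_same mcoeff0 (negPf s0) andbF.
by case: b; case: b' => /=; rewrite mcoeffU // eq_sym.
Qed.

Lemma cf_inj u : (forall b s, s != 0 -> cf b s u = 0) -> u = 0.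
Proof.
move=> u0; apply/malgP => -[] s; rewrite mcoeff0.
  by have := u0 false _ (valP s); rewrite /cf valK.
by have := u0 true _ (valP s); rewrite /cf valK.
Qed.

Lemma bvec_ind (P : qtSpace K -> Prop) :
    P 0 -> (forall c u v, P u -> P v -> P (c *: u + v)) ->
    (forall b m, P (bvec b m)) ->
  forall u, P u.
Proof.
move=> P0 PL Pb; apply: qt_ind => // m; [exact: (Pb false) | exact: (Pb true)].
Qed.

(** The coefficient at s of a vector moved by n is read off at s - n.  Both
    conditions on B absorb the boundary cases m = 0 and m + n = 0, where at
    least one of the two basis vectors degenerates to 0. *)
Lemma cf_shift (B : int * int -> K) b b' m n s : B 0 = 0 -> B (- n) = 0 ->
  B m * cf b s (bvec b' (m + n)) = B (s - n) * cf b (s - n) (bvec b' m).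
Proof.
move=> B0 Bn; rewrite !cf_bvec [_ - _ == m]subr_eq.
have [->|_] := eqVneq s (m + n); last by rewrite !andbF !mulr0.
rewrite addrK; have [->|m0] := eqVneq m 0; first by rewrite B0 !mul0r.
have [/eqP|//] := eqVneq (m + n) 0.
by rewrite addr_eq0 => /eqP ->; rewrite Bn !mul0r.
Qed.

Lemma brPl w c u v : br (c *: u + v) w = c *: br u w + br v w.
Proof. exact: qtbr_linear1. Qed.

Lemma br0l w : br 0 w = 0.
Proof. by rewrite linear0l. Qed.

Lemma br0r w : br w 0 = 0.
Proof. by rewrite linear0r. Qed.

Lemma cf_br_x b s u n : cf b s (br u (xvec n)) =
  if b then 0 else lam (s - n) n * cf false (s - n) u
                   + hcoef (s - n) n * cf true (s - n) u.
Proof.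
elim/bvec_ind: u => [|c u v IHu IHv|b' m].
- by rewrite br0l !cf0 !mulr0 addr0 if_same.
- rewrite brPl cfD cfZ {}IHu {}IHv; case: b; first by rewrite mulr0 addr0.
  by rewrite !cfD !cfZ; ring.
have lN : lam (- n) n = 0 by rewrite lam_anti lamNr ?lammm ?oppr0.
have hN : hcoef (- n) n = 0 by rewrite -{2}[n]opprK hcoefmN.
have xE k : xvec k = bvec false k by [].
case: b'; rewrite /bvec ?qtbr_xx ?qtbr_Dx cfZ !xE -?[Dvec m]/(bvec true m).
- case: b; first by rewrite cf_bvec mulr0.
  rewrite (cf_shift (B := hcoef^~ n)) ?hcoef0l //.
  by rewrite (cf_bvec _ _ true) mulr0 add0r !cf_bvec.
- case: b; first by rewrite cf_bvec mulr0.
  by rewrite (cf_bvec true) mulr0 addr0 (cf_shift (B := lam^~ n)) ?lam0l.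
Qed.

Lemma cf_br_D b s u n : cf b s (br u (Dvec n)) =
  if b then gcoef (s - n) n * cf true (s - n) u
  else - (hcoef n (s - n) * cf false (s - n) u).
Proof.
elim/bvec_ind: u => [|c u v IHu IHv|b' m].
- by rewrite br0l !cf0 !mulr0 oppr0 if_same.
- by rewrite brPl cfD cfZ {}IHu {}IHv; case: b; rewrite !cfD !cfZ; ring.
have gN : gcoef (- n) n = 0 by rewrite -{2}[n]opprK gcoefmN.
case: b'; rewrite /bvec ?qtbr_xD ?qtbr_DD ?cfN ?cfZ.
- rewrite -![Dvec _]/(bvec true _); case: b; last by rewrite !cf_bvec !mulr0 oppr0.
  by rewrite (cf_shift (B := gcoef^~ n)) ?gcoef0l.
- rewrite -![xvec _]/(bvec false _); case: b; first by rewrite !cf_bvec !mulr0 oppr0.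
  by rewrite addrC (cf_shift (B := hcoef n)) ?hcoef0r ?hcoefmN.
Qed.

Lemma cf_br_DT b s u m : inT m ->
  cf b s (br (Dvec m) u) = det m s * cf b (s - m) u.
Proof.
move=> mT; rewrite qtbr_anti cfN cf_br_D hcoef_T // gcoef_anti gcoef_T //.
by rewrite detDr detNr detmm subr0; case: b; rewrite ?opprK ?mulNr ?opprK.
Qed.

Lemma br_DT_bvec b m n : inT m ->
  br (Dvec m) (bvec b n) = det m n *: bvec b (m + n).
Proof.
by move=> mT; case: b; rewrite /= ?qtbr_DD ?qtbr_Dx ?gcoef_T ?hcoef_T.
Qed.

(** * Half-derivations *)

Definition half_derivation (phi : qtSpace K -> qtSpace K) :=
  linear phi /\
  forall u v, 2 *: phi (br u v) = br (phi u) v + br u (phi v).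

Lemma linear_funZ (phi : qtSpace K -> qtSpace K) c u : linear phi ->
  phi (c *: u) = c *: phi u.
Proof. by move=> phiL; exact: scalable_linear phiL c u. Qed.

Lemma linear_fun0 (phi : qtSpace K -> qtSpace K) : linear phi -> phi 0 = 0.
Proof.
by move=> phiL; have := linear_funZ 0 0 phiL; rewrite !scale0r.
Qed.

(** D(m) and D(2m) commute for m in T, which ties phi D(2m) to phi D(m). *)
Lemma half_der_double phi b r m : half_derivation phi -> inT m -> det m r != 0 ->
  cf b (r + (m + m)) (phi (Dvec (m + m))) = 2 * cf b (r + m) (phi (Dvec m)).
Proof.
case=> phiL phiB mT mr; have m2T : inT (m + m) by rewrite in_tZ2Dl.
have := congr1 (cf b (r + (m + m) + m)) (phiB (Dvec m) (Dvec (m + m))).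
rewrite qtbr_DD gcoef_T // detDr !detmm addr0 scale0r linear_fun0 // scaler0 cf0.
rewrite cfD (qtbr_anti _ _ (Dvec (m + m))) cfN !cf_br_DT // addrK.
rewrite (addrAC r) addrK !(detDr, detDl) !detmm !addr0 => E.
apply: (mulfI mr); apply/eqP; rewrite -subr_eq0; apply/eqP.
by rewrite [RHS]E; ring.
Qed.

(** [recursion_eq0] for the coefficient F m of phi (bvec b (n + m)) at s + m.
    The doubling law for e comes from [half_der_double] and is available when m
    is not proportional to s - n, hence the condition on l. *)
Lemma half_der_coef_eq0 phi b n b' s (l : K) : half_derivation phi ->
    s != 0 -> (l != 0 -> s - n != 0) ->
    (forall m m', inT m -> inT m' ->
       cf b' (s + m + m') (br (phi (Dvec m)) (bvec b (n + m'))) =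
       l * cf b' (s - n + m) (phi (Dvec m))) ->
  cf b' s (phi (bvec b n)) = 0.
Proof.
move=> phiH s0 ln He; have [phiL phiB] := phiH.
pose F m := cf b' (s + m) (phi (bvec b (n + m))).
pose e m := cf b' (s - n + m) (phi (Dvec m)).
suff : F 0 = 0 by rewrite /F !addr0.
apply: (@recursion_eq0 K t (prim_order_gt0 q_prim) F e l n s
          (if l == 0 then s else s - n)) => //.
- by case: eqVneq ln => // _ ->.
- move=> m m' mT mT'; rewrite /F /e.
  have := congr1 (cf b' (s + m + m')) (phiB (Dvec m) (bvec b (n + m'))).
  rewrite br_DT_bvec // linear_funZ // !cfZ cfD He // cf_br_DT //.
  rewrite (addrAC s m m') addrK !detDr !detmm addr0 -!addrA (addrCA m n).
  by rewrite (addrC m' m) mulrA.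
- move=> m mT; case: (eqVneq l 0) => [->|l0]; first by rewrite !mul0r mulr0.
  by move=> mw; rewrite /e half_der_double // mulrCA.
Qed.

(** Here c m stands for the coefficient at r + m of phi D(m), for phi sending H
    to C.  For m not proportional to r, the equations at (m, 2m), (m, r), (2m, r)
    and (m, m + r) only involve c at m, 2m, r, m + r and 2m + r, since
    det m (2m) = 0, and they force c m = 0; a vector proportional to r is a
    sum of two that are not. *)
Lemma recursion_shift_eq0 (c : int * int -> K) r : inT r -> r != 0 ->
    (forall m n, inT m -> inT n ->
       2 * det m n * c (m + n) = det (m + r) n * c m + det m (n + r) * c n) ->
  forall m, inT m -> m != 0 -> c m = 0.
Proof.
move=> rT r0 rec.
have gen m : inT m -> det m r != 0 -> c m = 0.
  move=> mT mr; have m2T : inT (m + m) by rewrite in_tZ2Dl.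
  have mrT : inT (m + r) by rewrite in_tZ2Dl.
  have rec0 i j iT jT := congr1 (fun x => x - (det (i + r) j * c i
    + det i (j + r) * c j)) (rec i j iT jT).
  have lincomb (x1 x2 x3 x4 : K) : x1 = 0 -> x2 = 0 -> x3 = 0 -> x4 = 0 ->
      2 * x1 + 2 * x2 - x3 + 2 * x4 = 0.
    by move=> -> -> -> ->; rewrite !mulr0 subr0 !addr0.
  have : 2 * det m r * c m = 0.
    have E1 := rec0 _ _ mT m2T; have E2 := rec0 _ _ mT rT.
    have E3 := rec0 _ _ m2T rT; have E4 := rec0 _ _ mT mrT.
    rewrite subrr in E1; rewrite subrr in E2.
    rewrite subrr in E3; rewrite subrr in E4.
    (* The coefficients of lincomb eliminate c at 2m, r, m + r and 2m + r. *)
    rewrite -[RHS](lincomb _ _ _ _ E1 E2 E3 E4) !(detDl, detDr, detmm).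
    by rewrite (det_anti _ m r) !addrA; ring.
  by move/eqP; rewrite !mulf_eq0 pnatr_eq0 (negPf mr) => /eqP.
move=> m mT m0; have [mr|] := eqVneq (det m r) 0; last exact: gen.
have [n [_ [nT _ _ /and3P[nm _ _] /and3P[nr _ _]]]] :=
  generic_pair K (prim_order_gt0 q_prim) m0 r0.
have mnT : inT (m - n) by rewrite in_tZ2Dl ?in_tZ2N.
have := rec _ _ mnT nT; rewrite subrK (gen n) // (gen (m - n)) //; last first.
  by rewrite det_anti detDr detNr (det_anti _ m r) mr oppr0 add0r opprK det_anti oppr_eq0.
rewrite !mulr0 addr0 => /eqP; rewrite !mulf_eq0 pnatr_eq0 /=.
rewrite det_anti detDr detNr detmm subr0 oppr_eq0 (negPf nm) /=.
by move/eqP.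
Qed.

(** For r = 0 the recursion says that c (m + n) is the mean of c m and c n when
    m and n are independent.  Computing c (m + 2n) in two ways expresses c m
    through c n and c (2n) alone, so any two values agree as both can be compared
    with a common independent n. *)
Lemma recursion_const (c : int * int -> K) :
    (forall m n, inT m -> inT n ->
       2 * det m n * c (m + n) = det m n * c m + det m n * c n) ->
  forall m n, inT m -> inT n -> m != 0 -> n != 0 -> c m = c n.
Proof.
move=> rec.
have mid m n : inT m -> inT n -> det n m != 0 -> 2 * c (m + n) = c m + c n.
  move=> mT nT nm; have mn : det m n != 0 by rewrite det_anti oppr_eq0.
  by apply: (mulfI mn); rewrite mulrDr -rec //; ring.
have ind m n : inT m -> inT n -> det n m != 0 -> c m = 3 * c n - 2 * c (n + n).
  move=> mT nT nm; have n2T : inT (n + n) by rewrite in_tZ2Dl.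
  have mnT : inT (m + n) by rewrite in_tZ2Dl.
  have E1 := mid _ _ mT nT nm.
  have E2 : 2 * c (m + n + n) = c (m + n) + c n.
    by apply: mid; rewrite // detDr detmm addr0.
  have E3 : 2 * c (m + (n + n)) = c m + c (n + n).
    by apply: mid; rewrite // detDl -mulr2n mulrn_eq0.
  rewrite addrA E2 in E3.
  have -> : c m = 2 * (c m + c (n + n)) - c m - 2 * c (n + n) by ring.
  by rewrite -E3 mulrDr E1; ring.
move=> m n mT nT m0 n0.
have [k [_ [kT _ _ /and3P[km _ _] /and3P[kn _ _]]]] :=
  generic_pair K (prim_order_gt0 q_prim) m0 n0.
by rewrite (ind m k) // (ind n k).
Qed.

(** * Commutative products by half-derivations *)

Section Product.
Hypothesis t_gt1 : (1 < t)%N.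
Variable mul : qtSpace K -> qtSpace K -> qtSpace K.
Hypothesis mulC : commutative mul.
Hypothesis mulH : forall z, half_derivation (mul z).
Implicit Types u v z : qtSpace K.

Lemma mul_linear z c u v : mul z (c *: u + v) = c *: mul z u + mul z v.
Proof. exact: (mulH z).1. Qed.

Lemma mulZr z c u : mul z (c *: u) = c *: mul z u.
Proof. exact: linear_funZ (mulH z).1. Qed.

Lemma mul_r0 z : mul z 0 = 0.
Proof. exact: linear_fun0 (mulH z).1. Qed.

(** Annihilation turns into centralisation: when z kills an ideal, this makes
    every multiple of z centralise that ideal. *)
Lemma mul_br0 z u v : mul z (br u v) = 0 -> mul z v = 0 -> br (mul z u) v = 0.
Proof.
move=> zuv zv; have := (mulH z).2 u v.
by rewrite zuv zv br0r addr0 scaler0.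
Qed.

(** The ideal A spanned by the x^n with n outside T is stable under mul z: the
    bracket of anything with an element of A is again in A, so it contributes
    nothing to the remaining coefficients and the recursion applies with l = 0. *)
Lemma cf_mul_x b z s n : ~~ inT n -> b || inT s ->
  cf b s (mul z (xvec n)) = 0.
Proof.
move=> nT bs; have [->|s0] := eqVneq s 0; first exact: cf_at0.
apply: (half_der_coef_eq0 (b := false) (l := 0)) (mulH z) s0 _ _.
  by rewrite eqxx.
move=> m m' mT mT'; rewrite mul0r cf_br_x; case: b bs => //= sT.
set k := s + m + m' - _.
have kT : inT (k + (n + m')) by rewrite subrK in_tZ2Dr // in_tZ2Dr.
have nkT : ~~ inT k.
  by apply: contra nT => kT'; rewrite -(in_tZ2Dl n kT') -(in_tZ2Dr _ mT') -addrA.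
by rewrite hcoefE (negPf nkT) lam_TD // !mul0r addr0.
Qed.

Lemma shiftK s n m m' : s + m + m' - (n + m') = s - n + m.
Proof. by rewrite opprD addrACA subrr addr0 addrAC. Qed.

(** By commutativity x^k * D(m) is in A, so that its bracket with x^n only
    involves the constant lam (s - n) n, which depends on degrees modulo T. *)
Lemma mul_xx k n : ~~ inT k -> ~~ inT n -> mul (xvec k) (xvec n) = 0.
Proof.
move=> kT nT; apply: cf_inj => b s s0.
have [bs|] := boolP (b || inT s); first exact: cf_mul_x.
rewrite negb_or => /andP[/negPf -> sT].
apply: (half_der_coef_eq0 (b := false) (l := lam (s - n) n)) (mulH _) s0 _ _.
  by apply: contraNneq => ->; rewrite lam0l.
move=> m m' mT mT'; rewrite cf_br_x shiftK lamDl // lamDr //.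
by rewrite (mulC (xvec k)) (cf_mul_x (b := true)) // mulr0 addr0.
Qed.

Lemma mul_br_x z v n : (forall k, ~~ inT k -> mul z (xvec k) = 0) ->
  ~~ inT n -> mul z (br v (xvec n)) = 0.
Proof.
move=> z0 nT; elim/bvec_ind: v => [|c u v IHu IHv|b m].
- by rewrite br0l mul_r0.
- by rewrite brPl mul_linear IHu IHv scaler0 addr0.
have [mnT|mnT] := boolP (inT (m + n)); last first.
  by case: b; rewrite /bvec ?qtbr_xx ?qtbr_Dx mulZr z0 ?scaler0.
have mT : inT m = false by apply: contraNF nT => /in_tZ2Dl <-.
by case: b; rewrite /bvec ?qtbr_xx ?qtbr_Dx ?hcoefE ?mT lam_TD // scale0r mul_r0.
Qed.

(** As A * A = 0 and A is an ideal, x^k * v centralises A; since it also lies in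
    A, which has trivial centre, it vanishes. *)
Lemma mul_x_Gamma2 k v : ~~ inT k -> mul (xvec k) v = 0.
Proof.
move=> kT; apply: cf_inj => b s s0.
have [bs|] := boolP (b || inT s); first by rewrite mulC cf_mul_x.
rewrite negb_or => /andP[/negPf -> sT].
have [n [nT sn]] := lam_neq0_ex t_gt1 sT.
have A : br (mul (xvec k) v) (xvec n) = 0.
  by apply: mul_br0; [apply: mul_br_x => // m; exact: mul_xx | exact: mul_xx].
have := congr1 (cf false (s + n)) A; rewrite cf_br_x cf0 addrK.
rewrite (mulC (xvec k)) (cf_mul_x (b := true)) // mulr0 addr0.
by move/eqP; rewrite mulf_eq0 (negPf sn) => /eqP.
Qed.

(** A is annihilated by the product, so every product centralises A.  The two
    lemmas that follow read this as membership in A' + C, the centraliser of A. *)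
Lemma br_mul_x u v n : ~~ inT n -> br (mul u v) (xvec n) = 0.
Proof.
have x0 k : ~~ inT k -> mul u (xvec k) = 0.
  by move=> kT; rewrite mulC mul_x_Gamma2.
by move=> nT; apply: mul_br0; [exact: mul_br_x | exact: x0].
Qed.

Lemma cf_true_mul_T u v k : inT k -> cf true k (mul u v) = 0.
Proof.
move=> kT; have [->|k0] := eqVneq k 0; first exact: cf_at0.
have [n [nT kn]] := det_neq0_ex t_gt1 k0.
have := congr1 (cf false (k + n)) (br_mul_x u v nT).
rewrite cf_br_x cf0 addrK lam_Tl // hcoef_T // mul0r add0r.
by move/eqP; rewrite mulf_eq0 (negPf kn) => /eqP.
Qed.

Lemma cf_false_mul_Gamma2 u v k : ~~ inT k -> cf false k (mul u v) = - cf true k (mul u v).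
Proof.
move=> kT; have [n [nT kn]] := lam_neq0_ex t_gt1 kT.
have := congr1 (cf false (k + n)) (br_mul_x u v nT).
rewrite cf_br_x cf0 addrK hcoefE (negPf kT) -mulrDr => /eqP.
by rewrite mulf_eq0 (negPf kn) addr_eq0 => /eqP.
Qed.

(** The D-coefficients of z * D(m) vanish on T, so the recursion for the
    D-coefficients of z * D(n) has the constant l = lam (s - n) n as in [mul_xx].
    An x-coefficient at a degree outside T is the opposite of a D-coefficient,
    and for one in T the recursion has l = 0, as [A' + C, D(n)] lies in A'. *)
Lemma mul_D_Gamma2 z n : ~~ inT n -> mul z (Dvec n) = 0.
Proof.
move=> nT.
have D0 s : cf true s (mul z (Dvec n)) = 0.
  have [sT|sT] := boolP (inT s); first exact: cf_true_mul_T.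
  apply: (half_der_coef_eq0 (b := true) (l := lam (s - n) n)) (mulH _) _ _ _.
  - exact: in_tZ2_neq0 sT.
  - by apply: contraNneq => ->; rewrite lam0l.
  move=> m m' mT mT'; rewrite cf_br_D shiftK gcoefE (in_tZ2Dr n mT') (in_tZ2Dr _ mT).
  rewrite (negPf nT) orbF lamDl // lamDr //.
  have [snT|//] := boolP (inT _).
  by rewrite cf_true_mul_T ?mulr0 // in_tZ2Dl.
apply: cf_inj => -[] s s0; first exact: D0.
have [sT|sT] := boolP (inT s); last by rewrite cf_false_mul_Gamma2 // D0 oppr0.
apply: (half_der_coef_eq0 (b := true) (l := 0)) (mulH _) s0 _ _.
  by rewrite eqxx.
move=> m m' mT mT'; rewrite mul0r cf_br_D hcoefE in_tZ2Dr // (negPf nT).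
by rewrite lam_TD ?mul0r ?oppr0 // addrC subrK in_tZ2Dr // in_tZ2Dr.
Qed.

(** Products lie in A' + C, which commutes with C, so the recursion has l = 0. *)
Lemma mul_x_T z n : inT n -> mul z (xvec n) = 0.
Proof.
move=> nT; apply: cf_inj => b s s0.
apply: (half_der_coef_eq0 (b := false) (l := 0)) (mulH _) s0 _ _.
  by rewrite eqxx.
move=> m m' mT mT'; rewrite mul0r cf_br_x; case: b => //.
have nT' : inT (n + m') by rewrite in_tZ2Dl.
rewrite lam_Tr // mul0r add0r hcoefE; case: ifP => kT.
  by rewrite cf_true_mul_T ?mulr0.
by rewrite lam_Tr ?mul0r.
Qed.

Lemma mul_x z n : mul z (xvec n) = 0.
Proof.
by have [/mul_x_T|/mul_x_Gamma2] := boolP (inT n); rewrite // mulC.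
Qed.

(** Membership in C: a product lies in A' + C, and z * D(n) centralises the D(m)
    with m outside T, as these are annihilated by z. *)
Lemma cf_mul_D_T b z s n : inT n -> b || ~~ inT s ->
  cf b s (mul z (Dvec n)) = 0.
Proof.
move=> nT bs; have [sT|sT] := boolP (inT s).
  by move: bs; rewrite sT orbF => ->; exact: cf_true_mul_T.
suff D0 : cf true s (mul z (Dvec n)) = 0.
  by case: b {bs}; rewrite ?cf_false_mul_Gamma2 ?D0 ?oppr0.
have [m [mT sm]] := lam_neq0_ex t_gt1 sT.
have A : br (mul z (Dvec n)) (Dvec m) = 0.
  apply: mul_br0; last exact: mul_D_Gamma2.
  by rewrite qtbr_DD mulZr mul_D_Gamma2 ?scaler0 // in_tZ2Dl.
have := congr1 (cf true (s + m)) A; rewrite cf_br_D cf0 addrK gcoefE.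
rewrite (negPf sT) (negPf mT) => /eqP.
by rewrite mulf_eq0 (negPf sm) => /eqP.
Qed.

Lemma mul_D_recursion z r m n : inT r -> inT m -> inT n ->
  2 * det m n * cf false (r + (m + n)) (mul z (Dvec (m + n))) =
  det (m + r) n * cf false (r + m) (mul z (Dvec m)) +
  det m (n + r) * cf false (r + n) (mul z (Dvec n)).
Proof.
move=> rT mT nT.
have := congr1 (cf false (r + (m + n))) ((mulH z).2 (Dvec m) (Dvec n)).
rewrite qtbr_DD mulZr gcoef_T // !cfZ cfD cf_br_DT // cf_br_D hcoef_T //.
rewrite addrA addrK (addrAC r) addrK -mulrA => ->.
by rewrite -mulNr -det_anti (addrC r m) !detDr detmm addr0 addrC (addrC (det m r)).
Qed.

(** By [recursion_shift_eq0], D(m) * D(n) is a multiple of x^n, with a factor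
    depending only on m by [recursion_const].  That factor can be computed with n
    replaced by any k independent of m; then the product is also a multiple of
    x^m by commutativity, so the factor is 0. *)
Lemma mul_DD_T m n : inT m -> inT n -> mul (Dvec m) (Dvec n) = 0.
Proof.
have off z s k : inT k -> s != k -> cf false s (mul z (Dvec k)) = 0.
  move=> kT sk; have [->|k0] := eqVneq k 0; first by rewrite Dvec0 mul_r0 cf0.
  have [sT|sT] := boolP (inT s); last exact: cf_mul_D_T.
  pose c j := cf false (s - k + j) (mul z (Dvec j)).
  have rT : inT (s - k) by rewrite in_tZ2Dl ?in_tZ2N.
  suff : c k = 0 by rewrite /c subrK.
  apply: (recursion_shift_eq0 (r := s - k)) => //; first by rewrite subr_eq0.
  by move=> *; exact: mul_D_recursion.
move=> mT nT; have [->|n0] := eqVneq n 0; first by rewrite Dvec0 mul_r0.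
have [->|m0] := eqVneq m 0; first by rewrite mulC Dvec0 mul_r0.
apply: cf_inj => b s s0.
have [bs|] := boolP (b || ~~ inT s); first exact: cf_mul_D_T.
rewrite negb_or negbK => /andP[/negPf -> sT].
have [->|sn] := eqVneq s n; last exact: off.
have [k [_ [kT _ _ /and3P[km _ _] _]]] :=
  generic_pair K (prim_order_gt0 q_prim) m0 m0.
have k0 : k != 0 by apply: contraNneq km => ->; rewrite det0l.
pose c j := cf false j (mul (Dvec m) (Dvec j)).
have -> : cf false n (mul (Dvec m) (Dvec n)) = c k.
  rewrite -/(c n); apply: recursion_const => // i j iT jT.
  have := mul_D_recursion (Dvec m) (in_tZ2_0 t) iT jT.
  by rewrite !addr0 !add0r.
rewrite /c mulC off //; apply: contraNneq km => ->; exact/eqP/detmm.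
Qed.

Lemma half_der_product_eq0 u v : mul u v = 0.
Proof.
elim/bvec_ind: v => [|c v w IHv IHw|[] n].
- exact: mul_r0.
- by rewrite mul_linear IHv IHw scaler0 addr0.
- have [nT|] := boolP (inT n); last exact: mul_D_Gamma2.
  rewrite /bvec mulC; elim/bvec_ind: u => [|c v w IHv IHw|[] m].
  + exact: mul_r0.
  + by rewrite mul_linear IHv IHw scaler0 addr0.
  + have [mT|] := boolP (inT m); last exact: mul_D_Gamma2.
    exact: mul_DD_T.
  + exact: mul_x.
- exact: mul_x.
Qed.

End Product.

End QuantumTorus.

Theorem theorem4p4 (R : realType) (t : nat) (q : R[i])
    (t_gt2 : (2 < t)%N) (q_prim : t.-primitive_root q)
    (mul : qtorus q_prim -> qtorus q_prim -> qtorus q_prim) :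
  transposed_poisson mul ->
  forall u v : qtorus q_prim, mul u v = 0.
Proof.
case=> mul_bil mulC _ mul_leibniz.
apply: (half_der_product_eq0 q_prim (ltnW t_gt2) mulC) => z.
by split=> [|u v]; [exact: mul_bil.2 | exact: mul_leibniz].
Qed.
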